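(* Let $X$ be a nonempty set, $\Omega\subseteq\mathcal P(X)$ an algebra, and $\mu$ a finite measure on $\Omega$. Then $(\bar\mu,\overline{\Omega})$, with the operations $\vee,\wedge,{}^{C}$ and the countable join $\vee^{\infty}$ described in the context, is a measure space: $\overline{\Omega}$ is closed under complements and countable joins, and $\bar\mu(\vee_{i=1}^{\infty}E_i)=\sum_{i=1}^{\infty}\bar\mu(E_i)$ whenever $E_i\wedge E_j=E_\phi$ for $i\ne j$.
   Context: A sequence $\{B_n\}\subseteq\Omega$ is $\mu$-Cauchy if $\mu(B_n\triangle B_m)\to0$ as $n,m\to\infty$. $\overline{\Omega}$ is the set of equivalence classes $\overline{\{B_n\}}$ of $\mu$-Cauchy sequences, where $\{A_n\}$ and $\{B_n\}$ are equivalent iff $\lim_n\mu(A_n\triangle B_n)=0$. Operations: $\overline{\{A_n\}}\vee\overline{\{B_n\}}=\overline{\{A_n\cup B_n\}}$, $\overline{\{A_n\}}\wedge\overline{\{B_n\}}=\overline{\{A_n\cap B_n\}}$, $\overline{\{B_n\}}^{C}=\overline{\{B_n^{C}\}}$; $E\le E'$ means $E\wedge E'=E$; $E_\phi$ is the class of the constant sequence $\emptyset$; $\bar\mu(\overline{\{B_n\}})=\lim_n\mu(B_n)$. For $E_1,E_2,\dots\in\overline{\Omega}$, $\vee_{i=1}^{\infty}E_i$ is the unique $E\in\overline{\Omega}$ such that (1) $\vee_{i=1}^{n}E_i\le E$ for all $n$ and (2) $\lim_n\bar\mu(E\wedge(\vee_{i=1}^nE_i)^{C})=0$. *)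

(* Defs.v *)
From mathcomp Require Import all_boot all_order all_algebra.
From mathcomp Require Import all_classical all_reals all_analysis.

Set Implicit Arguments.
Unset Strict Implicit.
Unset Printing Implicit Defensive.

Import Order.TTheory GRing.Theory Num.Theory.
Import numFieldNormedType.Exports.

Local Open Scope classical_set_scope.
Local Open Scope ring_scope.
Local Open Scope ereal_scope.

(* The algebra is [measurable : set (set T)]; an algebraOfSetsType is pointed,
   so the underlying set is nonempty. *)
Section completion.
Context {R : realType} {d : measure_display} {T : algebraOfSetsType d}.
Variable mu : set T -> \bar R.
Implicit Types (A B : (set T)^nat) (E F : set (set T)^nat).

Definition mu_cauchy B :=
  (forall n, measurable (B n)) /\
  mu (B k.1 `+` B k.2) @[k --> (\oo, \oo)] --> 0.

Definition mu_equiv A B := mu (A n `+` B n) @[n --> \oo] --> 0.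

Definition mu_class B : set (set T)^nat :=
  [set A | mu_cauchy A /\ mu_equiv A B].

Definition completion : set (set (set T)^nat) :=
  [set mu_class B | B in mu_cauchy].

(* The operations are unions of the classes obtained from all representatives.
   Lemmas class_joinE, class_meetE and class_complE below show that on
   [completion] this union is a single class, computed by any choice of
   representatives; in particular that the operations are well defined. *)
Definition class_join E F : set (set T)^nat :=
  \bigcup_(A in E) \bigcup_(B in F) mu_class (fun n => A n `|` B n).

Definition class_meet E F : set (set T)^nat :=
  \bigcup_(A in E) \bigcup_(B in F) mu_class (fun n => A n `&` B n).

Definition class_compl E : set (set T)^nat :=
  \bigcup_(B in E) mu_class (fun n => ~` B n).

Definition class_empty : set (set T)^nat := mu_class (fun=> set0).

Definition class_le E F := class_meet E F = E.

(* Independent of the representative [get E], see mu_barE. *)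
Definition mu_bar E : \bar R := limn (fun n => mu (get E n)).

Definition class_fin_join (E_ : nat -> set (set T)^nat) (n : nat) :=
  \big[class_join/class_empty]_(i < n) E_ i.

Definition is_countable_join (E_ : nat -> set (set T)^nat) E :=
  [/\ completion E,
      forall n, class_le (class_fin_join E_ n) E &
      mu_bar (class_meet E (class_compl (class_fin_join E_ n)))
        @[n --> \oo] --> 0].

End completion.

Section well_defined.
Context {R : realType} {d : measure_display} {T : algebraOfSetsType d}.
Variable mu : {measure set T -> \bar R}.
Hypothesis mufin : mu [set: T] < +oo.
Implicit Types (A B C : (set T)^nat) (S U V W : set T).

Let mY S U : measurable S -> measurable U -> measurable (S `+` U).
Proof. by move=> mS mU; apply: measurableU; exact: measurableD. Qed.

Let mu_sub2 S U V : measurable S -> measurable U -> measurable V ->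
  S `<=` U `|` V -> mu S <= mu U + mu V.
Proof.
move=> mS mU mV SUV; apply: le_trans (measureU2 _ mU mV).
by apply: le_measure => //; rewrite inE//; exact: measurableU.
Qed.

Let cvg0_sub2 (I : Type) (F : set_system I) (FF : Filter F)
    (f g h : I -> set T) :
  (forall i, measurable (f i)) -> (forall i, measurable (g i)) ->
  (forall i, measurable (h i)) -> (forall i, f i `<=` g i `|` h i) ->
  mu (g i) @[i --> F] --> 0 -> mu (h i) @[i --> F] --> 0 ->
  mu (f i) @[i --> F] --> 0.
Proof.
move=> mf mg mh fgh g0 h0.
apply: (@squeeze_cvge _ _ _ _ (cst 0) _ (fun i => mu (g i) + mu (h i))).
- by apply: nearW => i; rewrite measure_ge0 mu_sub2.
- exact: cvg_cst.
- by rewrite -[0 in X in _ --> X]adde0; apply: cvgeD.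
Qed.

Let setY_trans S U V : S `+` V `<=` (S `+` U) `|` (U `+` V).
Proof. by move=> x /=; have := EM (U x); tauto. Qed.

Let setYUU S U V W :
  (S `|` U) `+` (V `|` W) `<=` (S `+` V) `|` (U `+` W).
Proof. by move=> x /=; tauto. Qed.

Let setYII S U V W :
  (S `&` U) `+` (V `&` W) `<=` (S `+` V) `|` (U `+` W).
Proof.
by move=> x /=; have := EM (V x); have := EM (U x); have := EM (S x);
  have := EM (W x); tauto.
Qed.

Let setYCC S U : ~` S `+` ~` U = S `+` U.
Proof.
by apply/seteqP; split => x /=; have := EM (S x); have := EM (U x); tauto.
Qed.

Lemma mu_equiv_refl A : mu_equiv mu A A.
Proof.
rewrite /mu_equiv; under eq_fun do rewrite setYK measure0.
exact: cvg_cst.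
Qed.

Lemma mu_equiv_sym A B : mu_equiv mu A B -> mu_equiv mu B A.
Proof. by rewrite /mu_equiv; under eq_fun do rewrite setYC. Qed.

Lemma mu_equiv_trans A B C :
  (forall n, measurable (A n)) -> (forall n, measurable (B n)) ->
  (forall n, measurable (C n)) ->
  mu_equiv mu A B -> mu_equiv mu B C -> mu_equiv mu A C.
Proof.
move=> mA mB mC; apply: cvg0_sub2 => n; try exact: mY.
exact: setY_trans.
Qed.

Lemma mu_cauchyU A B : mu_cauchy mu A -> mu_cauchy mu B ->
  mu_cauchy mu (fun n => A n `|` B n).
Proof.
move=> [mA cA] [mB cB]; split=> [n|]; first exact: measurableU.
by apply: cvg0_sub2 cA cB => k; try exact: setYUU;
  apply: mY => //; exact: measurableU.
Qed.

Lemma mu_cauchyI A B : mu_cauchy mu A -> mu_cauchy mu B ->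
  mu_cauchy mu (fun n => A n `&` B n).
Proof.
move=> [mA cA] [mB cB]; split=> [n|]; first exact: measurableI.
by apply: cvg0_sub2 cA cB => k; try exact: setYII;
  apply: mY => //; exact: measurableI.
Qed.

Lemma mu_cauchyC A : mu_cauchy mu A -> mu_cauchy mu (fun n => ~` A n).
Proof.
move=> [mA cA]; split=> [n|]; first exact: measurableC.
by under eq_fun do rewrite setYCC.
Qed.

Lemma mu_class_refl A : mu_cauchy mu A -> mu_class mu A A.
Proof. by move=> cA; split=> //; exact: mu_equiv_refl. Qed.

Lemma mu_class_eq A B : mu_cauchy mu A -> mu_cauchy mu B ->
  mu_equiv mu A B -> mu_class mu A = mu_class mu B.
Proof.
move=> cA cB AB; apply/seteqP; split=> C [cC eC]; split=> //.
- exact: mu_equiv_trans cC.1 cA.1 cB.1 eC AB.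
- exact: mu_equiv_trans cC.1 cB.1 cA.1 eC (mu_equiv_sym AB).
Qed.

Lemma class_joinE A B : mu_cauchy mu A -> mu_cauchy mu B ->
  class_join mu (mu_class mu A) (mu_class mu B) =
  mu_class mu (fun n => A n `|` B n).
Proof.
move=> cA cB; apply/seteqP; split=> [C [A' [cA' eA]] [B' [cB' eB]]|C CAB].
- rewrite (@mu_class_eq _ (fun n => A n `|` B n)) //; try exact: mu_cauchyU.
  apply: cvg0_sub2 eA eB => n; try exact: setYUU;
    apply: mY; try (apply: measurableU);
    first [exact: cA'.1|exact: cB'.1|exact: cA.1|exact: cB.1].
- exists A; first exact: mu_class_refl.
  by exists B => //; exact: mu_class_refl.
Qed.

Lemma class_meetE A B : mu_cauchy mu A -> mu_cauchy mu B ->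
  class_meet mu (mu_class mu A) (mu_class mu B) =
  mu_class mu (fun n => A n `&` B n).
Proof.
move=> cA cB; apply/seteqP; split=> [C [A' [cA' eA]] [B' [cB' eB]]|C CAB].
- rewrite (@mu_class_eq _ (fun n => A n `&` B n)) //; try exact: mu_cauchyI.
  apply: cvg0_sub2 eA eB => n; try exact: setYII;
    apply: mY; try (apply: measurableI);
    first [exact: cA'.1|exact: cB'.1|exact: cA.1|exact: cB.1].
- exists A; first exact: mu_class_refl.
  by exists B => //; exact: mu_class_refl.
Qed.

Lemma class_complE A : mu_cauchy mu A ->
  class_compl mu (mu_class mu A) = mu_class mu (fun n => ~` A n).
Proof.
move=> cA; apply/seteqP; split=> [C [A' [cA' eA]]|C CA].
- rewrite (@mu_class_eq _ (fun n => ~` A n)) //; try exact: mu_cauchyC.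
  by rewrite /mu_equiv; under eq_fun do rewrite setYCC.
- by exists A => //; exact: mu_class_refl.
Qed.

Let mu_fin S : measurable S -> mu S \is a fin_num.
Proof. exact: (lty_fin_num_fun mufin). Qed.

Let dist_mu S U : measurable S -> measurable U ->
  `|fine (mu S) - fine (mu U)|%:E <= mu (S `+` U).
Proof.
move=> mS mU; have fY := mu_fin (mY mS mU).
rewrite -(fineK fY) lee_fin ler_distl; apply/andP; split.
- rewrite lerBlDr -lee_fin EFinD !fineK ?mu_fin//; last exact: mY.
  by apply: mu_sub2 => // [|x /=]; [exact: mY|have := EM (S x); tauto].
- rewrite -lee_fin EFinD !fineK ?mu_fin//; last exact: mY.
  by apply: mu_sub2 => // [|x /=]; [exact: mY|have := EM (U x); tauto].
Qed.

Lemma mu_cauchy_cvg A : mu_cauchy mu A -> cvgn (fun n => mu (A n)).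
Proof.
move=> [mA cA].
have -> : (fun n => mu (A n)) = EFin \o (fun n => fine (mu (A n))).
  by apply/funext => n /=; rewrite fineK ?mu_fin.
suff /cvg_ex[l cl] : cvgn (fun n => fine (mu (A n))).
  by apply/cvg_ex; exists l%:E; apply: cvg_EFin => //; exact: nearW.
apply/cauchy_cvgP/cauchy_ballP => e e0 /=.
have /fine_cvgP[_ /cvgrPdist_lt/(_ _ e0)] := cA.
move=> mA0; rewrite near_map2; apply: filterS mA0 => -[n m] /=.
rewrite sub0r normrN => lte.
rewrite /ball/= -lte_fin; apply: le_lt_trans (dist_mu (mA n) (mA m)) _.
rewrite -[ltLHS]fineK ?mu_fin//; last exact: mY.
by rewrite lte_fin; apply: le_lt_trans lte; exact: ler_norm.
Qed.

Lemma mu_equiv_lim A B : mu_cauchy mu A -> mu_cauchy mu B ->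
  mu_equiv mu A B -> limn (fun n => mu (A n)) = limn (fun n => mu (B n)).
Proof.
move=> cA cB AB; have mA := cA.1; have mB := cB.1; apply: cvg_lim => //.
have cl : mu (B n) @[n --> \oo] --> limn (fun n => mu (B n)).
  exact: mu_cauchy_cvg cB.
set l := limn _ in cl *.
apply: (@squeeze_cvge _ _ _ _ (fun n => mu (B n) - mu (A n `+` B n)) _
  (fun n => mu (B n) + mu (A n `+` B n))).
- apply: nearW => n; apply/andP; split.
  + rewrite leeBlDr ?mu_fin//; last exact: mY.
    by apply: mu_sub2 => // [|x /=]; [exact: mY|have := EM (A n x); tauto].
  + by apply: mu_sub2 => // [|x /=]; [exact: mY|have := EM (B n x); tauto].
- rewrite -[X in _ --> X]sube0; apply: cvgeB => //.
  exact: fin_num_adde_defl.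
- by rewrite -[X in _ --> X]adde0; apply: cvgeD => //; exact: fin_num_adde_defl.
Qed.

Lemma mu_barE A : mu_cauchy mu A ->
  mu_bar mu (mu_class mu A) = limn (fun n => mu (A n)).
Proof.
move=> cA; rewrite /mu_bar.
have [cG eG] : mu_class mu A (get (mu_class mu A)).
  by apply: (@xgetPex _ point); exists A; exact: mu_class_refl.
exact: mu_equiv_lim.
Qed.

End well_defined.

(* Main.v *)
(* The limit of [mu (A n `+` B n)] is a pseudometric on the Cauchy sequences,
   which vanishes exactly on equivalent pairs. It is complete, and the
   finite unions of the representatives form an increasing sequence of bounded
   measure, hence a Cauchy sequence. Being a countable join amounts to being a
   limit of these finite unions for this pseudometric, which gives existence
   and uniqueness; additivity follows because the limit measure is
   1-Lipschitz and finitely additive. *)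

Require Import Defs.
From mathcomp Require Import all_boot all_order all_algebra.
From mathcomp Require Import all_classical all_reals all_analysis.

Set Implicit Arguments.
Unset Strict Implicit.
Unset Printing Implicit Defensive.

Import Order.TTheory GRing.Theory Num.Theory.
Import numFieldNormedType.Exports.

Local Open Scope classical_set_scope.
Local Open Scope ring_scope.
Local Open Scope ereal_scope.

Section completion_measure.
Context {R : realType} {d : measure_display} {T : algebraOfSetsType d}.
Context (mu : {measure set T -> \bar R}) (mufin : mu [set: T] < +oo).
Implicit Types (A B C D : (set T)^nat) (U : nat -> (set T)^nat).

Local Notation cauchy := (mu_cauchy mu).

Let mu_fin (S : set T) : measurable S -> mu S \is a fin_num.
Proof. exact: (lty_fin_num_fun mufin). Qed.

(** * Limit measure and limit distance on Cauchy sequences *)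

Lemma squeeze0_cvge (I : Type) (F : set_system I) (FF : Filter F)
    (f g : I -> \bar R) :
  (forall i, 0 <= f i <= g i) -> g i @[i --> F] --> 0 -> f i @[i --> F] --> 0.
Proof.
move=> fg; apply: (squeeze_cvge (f := cst 0)); last exact: cvg_cst.
exact: nearW.
Qed.

Lemma setY_subU (S V W : set T) : S `+` W `<=` (S `+` V) `|` (V `+` W).
Proof. by move=> x /=; have := EM (V x); tauto. Qed.

(** By [mu_barE] this is [mu_bar] of the class of a Cauchy sequence [A]; it lets the estimates be
    made on sequences, without choosing representatives. *)
Definition lim_mu A : \bar R := limn (fun n => mu (A n)).

Definition lim_dist A B : \bar R := lim_mu (fun n => A n `+` B n).

Lemma lim_mu_cvg A : cauchy A -> mu (A n) @[n --> \oo] --> lim_mu A.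
Proof. exact: mu_cauchy_cvg. Qed.

Lemma lim_mu_ge0 A : cauchy A -> 0 <= lim_mu A.
Proof. by move=> cA; apply: lime_ge; [exact: lim_mu_cvg|exact: nearW]. Qed.

Lemma lim_mu_fin A : cauchy A -> lim_mu A \is a fin_num.
Proof.
move=> cA; rewrite ge0_fin_numE ?lim_mu_ge0//; apply: le_lt_trans mufin.
apply: lime_le; first exact: lim_mu_cvg.
by apply: nearW => n; apply: le_measure; rewrite ?inE//; exact: cA.1.
Qed.

Lemma mu_cauchy_cst (S : set T) : measurable S -> cauchy (fun=> S).
Proof.
move=> mS; split=> //; under eq_fun do rewrite setYK measure0.
exact: cvg_cst.
Qed.

Lemma lim_mu_cst (S : set T) : lim_mu (fun=> S) = mu S.
Proof. exact: lim_cst. Qed.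

Lemma lim_mu_set0 : lim_mu (fun=> set0) = 0.
Proof. by rewrite lim_mu_cst measure0. Qed.

Lemma mu_cauchyD A B : cauchy A -> cauchy B -> cauchy (fun n => A n `\` B n).
Proof.
move=> cA cB; under eq_fun do rewrite setDE.
exact: mu_cauchyI cA (mu_cauchyC cB).
Qed.

Lemma mu_cauchyY A B : cauchy A -> cauchy B -> cauchy (fun n => A n `+` B n).
Proof. by move=> cA cB; apply: mu_cauchyU; exact: mu_cauchyD. Qed.

(** Monotonicity and subadditivity of [mu] hold at each index and pass to the limit. Monotonicity of
    [lim_mu], the triangle inequality and the Lipschitz bound below are all instances. *)
Lemma lim_mu_leU A B C : cauchy A -> cauchy B -> cauchy C ->
  (forall n, A n `<=` B n `|` C n) -> lim_mu A <= lim_mu B + lim_mu C.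
Proof.
move=> cA cB cC ABC.
have fBC : lim_mu B +? lim_mu C by exact/fin_num_adde_defl/lim_mu_fin.
rewrite -limeD//; try exact: lim_mu_cvg.
apply: lee_lim; [exact: lim_mu_cvg| |].
  by apply: is_cvgeD => //; exact: lim_mu_cvg.
apply: nearW => n; apply: le_trans (measureU2 _ (cB.1 n) (cC.1 n)).
apply: le_measure; rewrite ?inE//; [exact: cA.1|].
by apply: measurableU; [exact: cB.1|exact: cC.1].
Qed.

Lemma le_lim_mu A B : cauchy A -> cauchy B ->
  (forall n, A n `<=` B n) -> lim_mu A <= lim_mu B.
Proof.
move=> cA cB AB; rewrite -[leRHS]adde0 -lim_mu_set0.
apply: lim_mu_leU => // [|n]; first exact: mu_cauchy_cst.
exact: subset_trans (AB n) (@subsetUl _ _ _).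
Qed.

(** Inclusion-exclusion at each index, where finiteness of [mu] allows the measure of the
    intersection to be moved across the equation. *)
Lemma lim_muUI A B : cauchy A -> cauchy B ->
  lim_mu A + lim_mu B =
  lim_mu (fun n => A n `|` B n) + lim_mu (fun n => A n `&` B n).
Proof.
move=> cA cB; have cU := mu_cauchyU cA cB; have cI := mu_cauchyI cA cB.
rewrite -!limeD; try exact: lim_mu_cvg;
  try exact/fin_num_adde_defl/lim_mu_fin.
congr (limn _); apply/funext => n.
have [mA mB] := (cA.1 n, cB.1 n).
rewrite measureUfinl ?subeK ?mu_fin//; first exact: measurableI.
by rewrite -ge0_fin_numE ?mu_fin.
Qed.

Lemma lim_dist0P A B : cauchy A -> cauchy B ->
  lim_dist A B = 0 <-> mu_equiv mu A B.
Proof.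
move=> cA cB; split=> [AB0|AB]; last exact: cvg_lim AB.
by rewrite /mu_equiv -[in X in _ --> X]AB0; exact/lim_mu_cvg/mu_cauchyY.
Qed.

Lemma lim_distC A B : lim_dist A B = lim_dist B A.
Proof. by rewrite /lim_dist; under eq_fun do rewrite setYC. Qed.

Lemma lim_dist_ge0 A B : cauchy A -> cauchy B -> 0 <= lim_dist A B.
Proof. by move=> cA cB; exact/lim_mu_ge0/mu_cauchyY. Qed.

Lemma lim_dist_triangle A B C : cauchy A -> cauchy B -> cauchy C ->
  lim_dist A C <= lim_dist A B + lim_dist B C.
Proof.
move=> cA cB cC; apply: lim_mu_leU => [||| n]; try exact: mu_cauchyY.
exact: setY_subU.
Qed.

Lemma lim_mu_le_dist A B : cauchy A -> cauchy B ->
  lim_mu A <= lim_mu B + lim_dist A B.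
Proof.
move=> cA cB; apply: lim_mu_leU => // [|n x /=]; first exact: mu_cauchyY.
by have := EM (B n x); tauto.
Qed.

(** For nested sequences the symmetric difference is [B n \ A n], and [B n] is the disjoint union of
    [A n] and this set, so [lim_muUI] applies with an empty intersection. *)
Lemma lim_dist_sub A B : cauchy A -> cauchy B -> (forall n, A n `<=` B n) ->
  lim_dist A B = lim_mu B - lim_mu A.
Proof.
move=> cA cB AB; have cBA := mu_cauchyD cB cA.
have -> : lim_dist A B = lim_mu (fun n => B n `\` A n).
  congr lim_mu; apply/funext => n; rewrite setY_def.
  have -> : A n `\` B n = set0 by rewrite setD_eq0.
  by rewrite set0U.
apply/esym/eqP; rewrite sube_eq ?lim_mu_fin//; last first.
  exact/fin_num_adde_defl/lim_mu_fin.
apply/eqP; rewrite addeC lim_muUI//.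
under [X in _ = lim_mu X + _]eq_fun do rewrite setDUK//.
under [X in _ = _ + lim_mu X]eq_fun do rewrite setDIK.
by rewrite lim_mu_set0 adde0.
Qed.

(** * Density of constant sequences and completeness *)

Lemma lim_dist_cst_cvg A : cauchy A ->
  lim_dist (fun=> A n) A @[n --> \oo] --> 0.
Proof.
move=> cA.
have cY n : cauchy (fun k => A n `+` A k).
  by apply: mu_cauchyY => //; apply/mu_cauchy_cst/cA.1.
apply/fine_cvgP; split; first by apply: nearW => n; exact: lim_mu_fin.
apply/cvgrPdist_le => e e0.
have /fine_cvgP[_ /cvgrPdist_le/(_ _ e0)] := cA.2.
(* The double limit bounds [mu (A n]+[A k)] by [e] on a product of two tails; with [n] fixed in the
   first, letting [k] run through the second bounds the limit distance. *)
move=> [[P Q] /= [[N _ NP] [M _ MQ]] PQ].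
exists N => // n Nn /=; rewrite sub0r normrN ger0_norm ?fine_ge0 ?lim_mu_ge0//.
rewrite -lee_fin fineK ?lim_mu_fin//; apply: lime_le; first exact: lim_mu_cvg.
exists M => // k Mk /=; have := PQ (n, k) (conj (NP _ Nn) (MQ _ Mk)).
rewrite /= sub0r normrN ger0_norm ?fine_ge0// -lee_fin fineK//.
exact/mu_fin/(cY n).1.
Qed.

(* Completeness, by the usual diagonal argument: [D n] is a term of [U n] at
   distance at most [1/(n+1)] from its limit. *)
Lemma completion_complete U : (forall n, cauchy (U n)) ->
  lim_dist (U k.1) (U k.2) @[k --> (\oo, \oo)] --> 0 ->
  exists2 D, cauchy D & lim_dist (U n) D @[n --> \oo] --> 0.
Proof.
move=> cU U0.
have /choice[f fP] n :
    exists k, lim_dist (fun=> U n k) (U n) <= (n.+1%:R^-1)%:E.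
  have /fine_cvgP[_] := lim_dist_cst_cvg (cU n).
  have e0 : (0 < n.+1%:R^-1 :> R)%R by rewrite invr_gt0 ltr0n.
  move=> /cvgrPdist_le/(_ _ e0)[k _ /(_ k (leqnn k))] /=.
  have cY : cauchy (fun m => U n k `+` U n m).
    by apply: mu_cauchyY => //; apply/mu_cauchy_cst/(cU n).1.
  rewrite sub0r normrN ger0_norm ?fine_ge0 ?lim_mu_ge0// -lee_fin fineK.
    by exists k.
  exact: lim_mu_fin.
pose D n := U n (f n); pose e (n : nat) : \bar R := (n.+1%:R^-1)%:E.
have e0 : e n @[n --> \oo] --> 0.
  by apply: cvg_EFin; [exact: nearW|exact: cvg_harmonic].
have cDn n : cauchy (fun=> D n) by apply/mu_cauchy_cst/(cU n).1.
have cD : cauchy D.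
  split=> [n|]; first exact: (cU n).1.
  apply: (@squeeze0_cvge _ _ _ _
    (fun k => e k.1 + (lim_dist (U k.1) (U k.2) + e k.2))).
    (* The measure of one set is [lim_mu] of a constant sequence, so the distance from [D n] to
       [D m] is estimated through [U n] and [U m]. *)
    move=> [n m] /=; rewrite measure_ge0/= -lim_mu_cst.
    apply: (le_trans (lim_dist_triangle (cDn n) (cU n) (cDn m))).
    apply: leeD; first exact: fP.
    apply: (le_trans (lim_dist_triangle (cU n) (cU m) (cDn m))).
    by apply: leeD => //; rewrite lim_distC; exact: fP.
  rewrite -[0 in X in _ --> X]adde0; apply: cvgeD => //.
    exact: cvg_comp cvg_fst e0.
  rewrite -[0 in X in _ --> X]adde0; apply: cvgeD => //.
  exact: cvg_comp cvg_snd e0.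
exists D => //.
apply: (@squeeze0_cvge _ _ _ _ (fun n => e n + lim_dist (fun=> D n) D)).
  move=> n; rewrite lim_dist_ge0//=.
  apply: (le_trans (lim_dist_triangle (cU n) (cDn n) cD)).
  by apply: leeD => //; rewrite lim_distC; exact: fP.
by rewrite -[0 in X in _ --> X]adde0; apply: cvgeD => //;
  exact: lim_dist_cst_cvg.
Qed.

Lemma nondecreasing_lim_dist U : (forall n, cauchy (U n)) ->
  (forall n m k, (n <= m)%N -> U n k `<=` U m k) ->
  lim_dist (U k.1) (U k.2) @[k --> (\oo, \oo)] --> 0.
Proof.
move=> cU ndU; pose u n := fine (lim_mu (U n)).
have ndu : {homo u : n m / (n <= m)%N >-> (n <= m)%R}.
  move=> n m nm; rewrite -lee_fin !fineK ?lim_mu_fin//.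
  by apply: le_lim_mu => // k; exact: ndU.
have ubu : has_ubound (range u).
  exists (fine (mu setT)) => _ [n _ <-].
  rewrite -lee_fin !fineK ?lim_mu_fin ?mu_fin// -lim_mu_cst.
  by apply: le_lim_mu => //; exact: mu_cauchy_cst.
have /cvg_ex[l ul] : cvgn u by exact: nondecreasing_is_cvgn.
(* Since the sequences increase, distances are gaps between the real numbers [u n], which converge
   as a bounded nondecreasing sequence. *)
have distE n m : lim_dist (U n) (U m) = `|u n - u m|%:E.
  wlog nm : n m / (n <= m)%N => [hw|].
    by have [/hw//|/ltnW/hw] := leqP n m; rewrite lim_distC distrC.
  rewrite lim_dist_sub// => [|k]; last exact: ndU.
  by rewrite distrC ger0_norm ?subr_ge0 ?ndu// EFinB !fineK ?lim_mu_fin.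
under eq_fun do rewrite distE.
apply: cvg_EFin; first exact: nearW.
rewrite -[X in _ --> X](@normr0 _ R^o) -(subrr l); apply: cvg_norm; apply: cvgB.
- exact: cvg_comp cvg_fst ul.
- exact: cvg_comp cvg_snd ul.
Qed.

(** * Finite unions of representatives and the countable join *)

Definition fin_union U (n : nat) : (set T)^nat :=
  fun k => \big[setU/set0]_(i < n) U i k.

Lemma fin_unionS U n :
  fin_union U n.+1 = fun k => fin_union U n k `|` U n k.
Proof. by apply/funext => k; rewrite /fin_union big_ord_recr. Qed.

Lemma fin_union0 U : fin_union U 0 = fun=> set0.
Proof. by apply/funext => k; rewrite /fin_union big_ord0. Qed.

Lemma mu_cauchy_fin_union U n : (forall i, cauchy (U i)) ->
  cauchy (fin_union U n).
Proof.
move=> cU; elim: n => [|n IHn].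
  by rewrite fin_union0; exact: mu_cauchy_cst.
by rewrite fin_unionS; exact: mu_cauchyU.
Qed.

Lemma fin_union_nondecreasing U n m k : (n <= m)%N ->
  fin_union U n k `<=` fin_union U m k.
Proof.
elim: m => [|m IHm]; first by rewrite leqn0 => /eqP->.
rewrite leq_eqVlt => /predU1P[->//|/IHm/subset_trans]; apply.
by rewrite fin_unionS; exact: subsetUl.
Qed.

Lemma class_fin_joinE U n : (forall i, cauchy (U i)) ->
  class_fin_join mu (fun i => mu_class mu (U i)) n =
  mu_class mu (fin_union U n).
Proof.
move=> cU; rewrite /class_fin_join /fin_union.
(* Cauchyness is carried through the induction on the list of indices because [class_joinE] requires
   it at each step. *)
suff [] : cauchy (fun k => \big[setU/set0]_(i < n) U i k) /\
  \big[class_join mu/class_empty mu]_(i < n) mu_class mu (U i) =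
  mu_class mu (fun k => \big[setU/set0]_(i < n) U i k) by [].
elim: (index_enum _) => [|i r [cr IHr]].
  under eq_fun do rewrite big_nil; rewrite big_nil.
  by split=> //; exact: mu_cauchy_cst.
under eq_fun do rewrite big_cons; rewrite big_cons IHr.
by split; [exact: mu_cauchyU|exact: class_joinE].
Qed.

(** The two halves of the symmetric difference match the two conditions: the order condition says
    that [V n \ D] is null in the limit, and the other that the limit measure of [D \ V n] tends to
    0. *)
Lemma is_countable_joinE U D : (forall i, cauchy (U i)) -> cauchy D ->
  is_countable_join mu (fun i => mu_class mu (U i)) (mu_class mu D) <->
  lim_dist (fin_union U n) D @[n --> \oo] --> 0.
Proof.
move=> cU cD; have cV n := mu_cauchy_fin_union n cU.
have cVD n := mu_cauchyD (cV n) cD; have cDV n := mu_cauchyD cD (cV n).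
pose V := fin_union U.
have leE n : class_le mu (class_fin_join mu (fun i => mu_class mu (U i)) n)
    (mu_class mu D) <-> lim_mu (fun k => V n k `\` D k) = 0.
  rewrite /class_le class_fin_joinE// class_meetE//.
  have cI : cauchy (fun k => V n k `&` D k) by exact: mu_cauchyI.
  have -> : lim_mu (fun k => V n k `\` D k) =
      lim_dist (fun k => V n k `&` D k) (V n).
    congr lim_mu; apply/funext => k.
    by apply/seteqP; split=> x /=; have := EM (D k x); tauto.
  rewrite lim_dist0P//; split=> [VD|]; last exact: mu_class_eq.
  (* Equality of the classes is used through membership: the left representative lies in the class
     of [V n]. *)
  have [_] : mu_class mu (V n) (fun k => V n k `&` D k).
    by rewrite -VD; exact: mu_class_refl.
  by [].
have complE n : mu_bar mu (class_meet mu (mu_class mu D)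
    (class_compl mu (class_fin_join mu (fun i => mu_class mu (U i)) n))) =
    lim_mu (fun k => D k `\` V n k).
  have cC := mu_cauchyC (cV n).
  rewrite class_fin_joinE// class_complE// class_meetE// mu_barE//.
  by under eq_fun do rewrite -setDE.
rewrite /is_countable_join; under [X in [/\ _, _ & X @ _ --> _]]eq_fun do
  rewrite complE.
split=> [[_ VD0 DV0]|dist0].
  apply: squeeze0_cvge DV0 => n; rewrite lim_dist_ge0//=.
  rewrite -[leRHS]add0e -((leE n).1 (VD0 n)).
  by apply: lim_mu_leU => // [|k]; [exact: mu_cauchyY|rewrite setY_def].
split=> [|n|]; first by exists D.
  apply/leE/le_anti; rewrite lim_mu_ge0// andbT.
  (* For [m >= n], [V n \ D] is contained in [V m \ D], so its limit measure is at most the distance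
     from [V m] to [D], which tends to 0 in [m]. *)
  apply: (cvge_to_ge dist0); exists n => // m nm /=.
  apply: le_lim_mu => [||k x [Vx Dx]]; [by []|exact: mu_cauchyY|left].
  by split=> //; exact: fin_union_nondecreasing Vx.
apply: squeeze0_cvge dist0 => n; rewrite lim_mu_ge0//=.
by apply: le_lim_mu => // [|k x]; [exact: mu_cauchyY|right].
Qed.

(** * Finite additivity and continuity of the limit measure *)

Lemma lim_mu_fin_union U n : (forall i, cauchy (U i)) ->
  (forall i j, i != j -> lim_mu (fun k => U i k `&` U j k) = 0) ->
  lim_mu (fin_union U n) = \sum_(i < n) lim_mu (U i).
Proof.
move=> cU U0; have cV m := mu_cauchy_fin_union m cU.
(* The representatives may overlap, but only in sets of limit measure 0; subadditivity keeps the
   overlap of a finite union with any later term null. *)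
have VU0 m i : (m <= i)%N -> lim_mu (fun k => fin_union U m k `&` U i k) = 0.
  elim: m => [|m IHm] mi.
    rewrite fin_union0; under eq_fun do rewrite set0I.
    by rewrite lim_mu_set0.
  apply/le_anti; rewrite lim_mu_ge0 ?andbT; last exact: mu_cauchyI.
  rewrite -[leRHS]adde0 -{1}(IHm (ltnW mi)) -(U0 m i) ?ltn_eqF//.
  apply: lim_mu_leU => [|||k]; try exact: mu_cauchyI.
  by rewrite fin_unionS setIUl.
elim: n => [|n IHn].
  by rewrite fin_union0 big_ord0 lim_mu_set0.
rewrite big_ord_recr/= -IHn lim_muUI// VU0// adde0.
by rewrite fin_unionS.
Qed.

Lemma lim_dist_cvg_lim_mu U D : (forall n, cauchy (U n)) -> cauchy D ->
  lim_dist (U n) D @[n --> \oo] --> 0 -> lim_mu (U n) @[n --> \oo] --> lim_mu D.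
Proof.
move=> cU cD UD; have fD := lim_mu_fin cD.
apply: (@squeeze_cvge _ _ _ _ (fun n => lim_mu D - lim_dist (U n) D) _
  (fun n => lim_mu D + lim_dist (U n) D)).
- apply: nearW => n; rewrite lim_mu_le_dist// andbT.
  rewrite leeBlDr ?lim_mu_fin//; last exact: mu_cauchyY.
  by rewrite lim_distC; exact: lim_mu_le_dist.
- rewrite -[X in _ --> X]sube0; apply: cvgeB => //.
    exact: fin_num_adde_defr.
  exact: cvg_cst.
- rewrite -[X in _ --> X]adde0; apply: cvgeD => //.
    exact: fin_num_adde_defr.
  exact: cvg_cst.
Qed.

(** * Existence, uniqueness and measure of countable joins *)

Lemma completion_seq_rep (E_ : nat -> set (set T)^nat) :
  (forall i, completion mu (E_ i)) ->
  exists2 U, (forall i, cauchy (U i)) & E_ = fun i => mu_class mu (U i).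
Proof.
move=> cE; have /choice[U UP] i : exists A, cauchy A /\ mu_class mu A = E_ i.
  by have [A] := cE i; exists A.
exists U => [i|]; first exact: (UP i).1.
by apply/funext => i; rewrite (UP i).2.
Qed.

(** Completeness provides a limit of the finite unions, and two limits are at distance 0, hence
    represent the same class. *)
Lemma countable_join_unique_exists (E_ : nat -> set (set T)^nat) :
  (forall i, completion mu (E_ i)) -> exists! E, is_countable_join mu E_ E.
Proof.
move=> /completion_seq_rep[U cU ->]; have cV n := mu_cauchy_fin_union n cU.
have [|D cD VD] := completion_complete cV.
  by apply: nondecreasing_lim_dist => // n m k; exact: fin_union_nondecreasing.
exists (mu_class mu D); split; first exact/is_countable_joinE.
move=> E joinE; have [[D' cD' DE] _ _] := joinE.
move: joinE; rewrite -DE => /is_countable_joinE -/(_ cU cD') VD'.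
apply: mu_class_eq => //; apply/lim_dist0P => //.
apply/le_anti; rewrite lim_dist_ge0// andbT.
apply: (@cvge_to_ge _ \oo _ _
  (fun n => lim_dist (fin_union U n) D + lim_dist (fin_union U n) D')).
  by rewrite -[0 in X in _ --> X]adde0; exact: cvgeD.
apply: nearW => n; rewrite [X in X + _]lim_distC.
exact: lim_dist_triangle.
Qed.

Lemma mu_bar_class_empty : mu_bar mu (class_empty mu) = 0.
Proof.
rewrite mu_barE//; last exact: mu_cauchy_cst.
by rewrite -/(lim_mu _) lim_mu_set0.
Qed.

Lemma mu_bar_countable_join (E_ : nat -> set (set T)^nat) E :
  (forall i, completion mu (E_ i)) ->
  (forall i j, i != j -> class_meet mu (E_ i) (E_ j) = class_empty mu) ->
  is_countable_join mu E_ E ->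
  mu_bar mu E = \sum_(0 <= i <oo) mu_bar mu (E_ i).
Proof.
move=> /completion_seq_rep[U cU ->] dU joinE.
have [[D cD DE] _ _] := joinE.
move: joinE; rewrite -DE => /is_countable_joinE -/(_ cU cD) VD.
have cV n := mu_cauchy_fin_union n cU.
rewrite mu_barE// -/(lim_mu _); apply/esym/cvg_lim => //.
(* The partial sums of the series are the limit measures of the finite unions, which converge to
   that of [D]. *)
rewrite (_ : (fun n => _) = fun n => lim_mu (fin_union U n)).
  exact: lim_dist_cvg_lim_mu.
apply/funext => n; rewrite lim_mu_fin_union// => [|i j ij].
  by rewrite big_mkord; apply: eq_bigr => i _; rewrite mu_barE.
rewrite -mu_bar_class_empty -(dU i j ij) class_meetE// mu_barE//.
exact: mu_cauchyI.
Qed.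

End completion_measure.

(** The countable join is encoded as a relation that includes membership in [completion], so closure
    under it takes the form of unique existence. *)
Theorem theorem2 (R : realType) (d : measure_display)
    (T : algebraOfSetsType d) (mu : {measure set T -> \bar R})
    (mufin : mu [set: T] < +oo) :
  [/\ completion mu (class_empty mu),
      forall E, completion mu E -> completion mu (class_compl mu E) &
      forall E_ : nat -> set (set T)^nat,
        (forall i, completion mu (E_ i)) ->
        exists! E, is_countable_join mu E_ E] /\
  [/\ mu_bar mu (class_empty mu) = 0,
      forall E, completion mu E -> 0 <= mu_bar mu E &
      forall (E_ : nat -> set (set T)^nat) (E : set (set T)^nat),
        (forall i, completion mu (E_ i)) ->
        (forall i j, i != j ->
           class_meet mu (E_ i) (E_ j) = class_empty mu) ->
        is_countable_join mu E_ E ->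
        mu_bar mu E = \sum_(0 <= i <oo) mu_bar mu (E_ i)].
Proof.
split; split.
- by exists (fun=> set0) => //; exact: mu_cauchy_cst.
- move=> _ [A cA <-]; rewrite class_complE//.
  by exists (fun n => ~` A n) => //; exact: mu_cauchyC.
- exact: countable_join_unique_exists.
- exact: mu_bar_class_empty.
- by move=> _ [A cA <-]; rewrite mu_barE//; exact: lim_mu_ge0.
- exact: mu_bar_countable_join.
Qed.
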